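(* Let $0<\alpha\le1$, $m\in[0,1]$, $b>0$, let $(0,1)\subseteq I\subseteq\mathbb{R}$ and let $h:I\to\mathbb{R}^{\alpha}$ be non-negative. If $\mathcal{G},\mathcal{M}:[0,b]\to\mathbb{R}^{\alpha}$ are generalized $(h-m)$-convex functions and $\lambda>0$, then: (i) $\mathcal{G}+\mathcal{M}$ is generalized $(h-m)$-convex; (ii) $\lambda\mathcal{G}$ is generalized $(h-m)$-convex.
   Context: For $0<\alpha\le1$, $\mathbb{R}^{\alpha}$ is Yang's fractal set of $\alpha$-type real numbers $a^{\alpha}$ ($a\in\mathbb{R}$), with $a^{\alpha}+b^{\alpha}=(a+b)^{\alpha}$ and $a^{\alpha}b^{\alpha}=(ab)^{\alpha}$ (both operations commutative and associative, multiplication distributing over addition, neutral elements $0^{\alpha}$ and $1^{\alpha}$), ordered by $a^{\alpha}\le b^{\alpha}$ iff $a\le b$. Generalized $(h-m)$-convexity: let $(0,1)\subseteq I\subseteq\mathbb{R}$, let $h:I\to\mathbb{R}^{\alpha}$ be non-negative, and $m\in[0,1]$. A function $\mathcal{G}:[0,b]\to\mathbb{R}^{\alpha}$ is generalized $(h-m)$-convex if it is positive (in the sense $\mathcal{G}\ge0^{\alpha}$) and $\mathcal{G}(\gamma\nu+m(1-\gamma)\mu)\le h(\gamma)\mathcal{G}(\nu)+m^{\alpha}h(1-\gamma)\mathcal{G}(\mu)$ for all $\nu,\mu\in[0,b]$ and all $\gamma\in(0,1)$. *)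

(* Defs.v *)
From HB Require Import structures.
From mathcomp Require Import all_boot all_order all_algebra.
From mathcomp Require Import all_classical all_reals.

Set Implicit Arguments.
Unset Strict Implicit.
Unset Printing Implicit Defensive.

Import Order.TTheory GRing.Theory Num.Theory.
Local Open Scope classical_set_scope.
Local Open Scope ring_scope.

(* Yang's set R^alpha: [FPow alpha a] is the formal symbol a^alpha.  It is not
   a real power: a^alpha + b^alpha = (a + b)^alpha.  The exponent is an index
   of the type only, so that the operations are defined for every alpha. *)
Record fractal (R : realType) (alpha : R) := FPow { fbase : R }.
Arguments FPow {R} alpha fbase.
Arguments fbase {R alpha} _.

Section Fractal.
Context {R : realType} {alpha : R}.
Local Notation F := (fractal alpha).
Implicit Types (x y z : F) (a b : R).

Lemma FPowK : cancel (@fbase R alpha) (FPow alpha).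
Proof. by case. Qed.

Lemma fbase_inj : injective (@fbase R alpha).
Proof. exact: can_inj FPowK. Qed.

HB.instance Definition _ := Choice.copy F (can_type FPowK).

Definition fadd x y : F := FPow alpha (fbase x + fbase y).
Definition fopp x : F := FPow alpha (- fbase x).
Definition fmul x y : F := FPow alpha (fbase x * fbase y).
Definition fscale a x : F := FPow alpha (a * fbase x).
Definition fle x y : bool := fbase x <= fbase y.
Definition flt x y : bool := fbase x < fbase y.

Fact faddA : associative fadd.
Proof. by move=> x y z; rewrite /fadd /= addrA. Qed.
Fact faddC : commutative fadd.
Proof. by move=> x y; rewrite /fadd addrC. Qed.
Fact fadd0 : left_id (FPow alpha 0) fadd.
Proof. by move=> [x]; rewrite /fadd /= add0r. Qed.
Fact faddN : left_inverse (FPow alpha 0) fopp fadd.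
Proof. by move=> x; rewrite /fadd /= addNr. Qed.

HB.instance Definition _ := GRing.isZmodule.Build F faddA faddC fadd0 faddN.

Fact fmulA : associative fmul.
Proof. by move=> x y z; rewrite /fmul /= mulrA. Qed.
Fact fmulC : commutative fmul.
Proof. by move=> x y; rewrite /fmul mulrC. Qed.
Fact fmul1 : left_id (FPow alpha 1) fmul.
Proof. by move=> [x]; rewrite /fmul /= mul1r. Qed.
Fact fmulDl : left_distributive fmul +%R.
Proof. by move=> x y z; rewrite /fmul /= mulrDl. Qed.
Fact fone_neq0 : FPow alpha 1 != 0.
Proof. by apply/eqP => -[] /eqP; rewrite oner_eq0. Qed.

HB.instance Definition _ :=
  GRing.Zmodule_isComNzRing.Build F fmulA fmulC fmul1 fmulDl fone_neq0.

Fact fscaleA a b x : fscale a (fscale b x) = fscale (a * b) x.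
Proof. by rewrite /fscale /= mulrA. Qed.
Fact fscale1 : left_id 1 fscale.
Proof. by move=> [x]; rewrite /fscale /= mul1r. Qed.
Fact fscaleDr : right_distributive fscale +%R.
Proof. by move=> a x y; rewrite /fscale /= mulrDr. Qed.
Fact fscaleDl x : {morph fscale^~ x : a b / a + b}.
Proof. by move=> a b; rewrite /fscale /= mulrDl. Qed.

HB.instance Definition _ :=
  GRing.Zmodule_isLmodule.Build R F fscaleA fscale1 fscaleDr fscaleDl.

Fact flt_def x y : flt x y = (y != x) && fle x y.
Proof. by rewrite /flt /fle lt_def (inj_eq fbase_inj). Qed.
Fact fle_refl : reflexive fle.
Proof. by move=> x; exact: lexx. Qed.
Fact fle_anti : antisymmetric fle.
Proof. by move=> x y /le_anti/fbase_inj. Qed.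
Fact fle_trans : transitive fle.
Proof. by move=> y x z; exact: le_trans. Qed.
Fact fle_total : total fle.
Proof. by move=> x y; exact: le_total. Qed.

HB.instance Definition _ :=
  Order.isPOrder.Build ring_display F flt_def fle_refl fle_anti fle_trans.
HB.instance Definition _ := Order.POrder_isTotal.Build ring_display F fle_total.

End Fractal.

Section FractalTheory.
Context {R : realType} (alpha : R).
Implicit Types (a b : R) (x : fractal alpha).

Lemma FPow0 : FPow alpha 0 = 0.
Proof. by []. Qed.

Lemma FPow1 : FPow alpha 1 = 1.
Proof. by []. Qed.

Lemma FPowD a b : FPow alpha a + FPow alpha b = FPow alpha (a + b).
Proof. by []. Qed.

Lemma FPowM a b : FPow alpha a * FPow alpha b = FPow alpha (a * b).
Proof. by []. Qed.

Lemma le_FPow a b : (FPow alpha a <= FPow alpha b) = (a <= b).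
Proof. by []. Qed.

(* A real scalar acts on R^alpha through a |-> a^alpha. *)
Lemma fscaleE a x : a *: x = FPow alpha a * x.
Proof. by []. Qed.

End FractalTheory.

(* A function on [0, b] is represented by a total function, of which only the
   values on [0, b] are constrained; likewise only the values of [h] on
   ]0, 1[ are used. *)
Definition gen_hm_convex (R : realType) (alpha : R)
    (h : R -> fractal alpha) (m b : R) (G : R -> fractal alpha) : Prop :=
  (forall x, x \in `[0, b] -> 0 <= G x) /\
  (forall nu mu gamma : R,
     nu \in `[0, b] -> mu \in `[0, b] -> gamma \in `]0, 1[ ->
     G (gamma * nu + m * (1 - gamma) * mu)
       <= h gamma * G nu + FPow alpha m * h (1 - gamma) * G mu).

(* Main.v *)
Require Import Defs.
From mathcomp Require Import all_boot all_order all_algebra.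
From mathcomp Require Import all_classical all_reals.

Set Implicit Arguments.
Unset Strict Implicit.
Unset Printing Implicit Defensive.

Import Order.TTheory GRing.Theory Num.Theory.
Local Open Scope classical_set_scope.
Local Open Scope ring_scope.

(** The defining inequality of generalized [(h-m)]-convexity is linear in the
    function: its left-hand side evaluates the function at one point, and its
    right-hand side is a combination of two other values with coefficients
    [h gamma] and [m^alpha h (1 - gamma)] that do not depend on the function.
    Hence two such inequalities may be added, and one may be multiplied by a
    nonnegative scalar, provided that the order of [R^alpha] is compatible with
    addition and with nonnegative scaling.  Both compatibilities
    ([fractal_leD], [fractal_le_scale]) are inherited from the reals, because
    order, sum and scaling are all computed on the base [a] of [a^alpha]; what
    remains is distributivity and commutativity in the ring [R^alpha]. *)

Lemma fractal_leD (R : realType) (alpha : R) (x y z t : fractal alpha) :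
  x <= y -> z <= t -> x + z <= y + t.
Proof. exact: lerD. Qed.

Lemma fractal_le_scale (R : realType) (alpha c : R) (x y : fractal alpha) :
  0 <= c -> x <= y -> c *: x <= c *: y.
Proof. by move=> c0; exact: ler_wpM2l. Qed.

Lemma gen_hm_convexD (R : realType) (alpha m b : R)
    (h G M : R -> fractal alpha) :
  gen_hm_convex h m b G -> gen_hm_convex h m b M ->
  gen_hm_convex h m b (G \+ M).
Proof.
move=> [G0 Gcvx] [M0 Mcvx]; split=> [x xb | nu mu gamma nub mub gamma01] /=.
  by rewrite -[0]addr0; apply: fractal_leD; [exact: G0 | exact: M0].
by rewrite !(mulrDr _ (G _)) addrACA; apply: fractal_leD; [exact: Gcvx | exact: Mcvx].
Qed.

(** Scaling by zero is harmless: the zero function is generalized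
    [(h-m)]-convex. *)
Lemma gen_hm_convexZ (R : realType) (alpha m b c : R)
    (h G : R -> fractal alpha) :
  0 <= c -> gen_hm_convex h m b G -> gen_hm_convex h m b (c \*: G).
Proof.
move=> c0 [G0 Gcvx]; split=> [x xb | nu mu gamma nub mub gamma01] /=.
  by rewrite -(scaler0 _ c); apply: fractal_le_scale => //; exact: G0.
(* Rewriting the scalar as the ring element c^alpha lets it commute past the
   coefficients of the convexity inequality. *)
have scaleCA (k x : fractal alpha) : k * (c *: x) = c *: (k * x).
  by rewrite !fscaleE mulrCA.
by rewrite !scaleCA -scalerDr; apply: fractal_le_scale => //; exact: Gcvx.
Qed.

Theorem proposition2 (R : realType) (alpha m b : R) (I : set R)
    (h G M : R -> fractal alpha) (lambda : R)
    (halpha : 0 < alpha <= 1) (hm : 0 <= m <= 1) (hb : 0 < b)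
    (hI : `]0, 1[ `<=` I) (hh : forall t, I t -> 0 <= h t)
    (hG : gen_hm_convex h m b G) (hM : gen_hm_convex h m b M)
    (hlambda : 0 < lambda) :
  gen_hm_convex h m b (G \+ M) /\ gen_hm_convex h m b (lambda \*: G).
Proof.
by split; [exact: gen_hm_convexD | exact: gen_hm_convexZ (ltW hlambda) hG].
Qed.
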